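(* Let $\mathbb F$ be a field, let $(G,\psi)$ be an $(\mathbb F^+\rtimes\mathbb F^\times)$-gain graph, and let $D$ be an orientation of $G$. Then the matrix $A(D,\psi)$ represents $M(\mathbb F^+\rtimes\mathbb F^\times,\mathbb F^+,\mathcal A,G,\psi)$ over $\mathbb F$; that is, the vector matroid of $A(D,\psi)$ (on the column set $E(G)$) equals $M(\mathbb F^+\rtimes\mathbb F^\times,\mathbb F^+,\mathcal A,G,\psi)$.
   Context: $\Gamma=\mathbb F^+\rtimes\mathbb F^\times$ is the group on $\mathbb F\times\mathbb F^\times$ with $(a,b)\circ(c,d)=(a+bc,bd)$, identity $\varepsilon=(0,1)$ (equivalently, the affine maps $x\mapsto a+bx$ of $\mathbb F$). $\mathbb F^+$ denotes the normal subgroup $\{(a,1):a\in\mathbb F\}$. $\mathcal A=\{A_x:x\in\mathbb F\}$ where $A_x=\{(a,b):a+bx=x\}$ is the stabilizer of the point $x$; thus $(a,b),(c,d)$ with $b,d\ne1$ lie in the same member of $\mathcal A$ iff $a/(1-b)=c/(1-d)$. Gain graphs: graphs may have loops and parallel edges; a $\Gamma$-gain function $\psi$ maps oriented edges $(e,u,v)$ to $\Gamma$ with $\psi(e,u,v)=\psi(e,v,u)^{-1}$ for $u\ne v$; a cycle is $\psi$-balanced if the product of gains along some simple closed walk around it is $\varepsilon$. $\psi(X)$ is the set of gains of orientations of edges in $X$. Switching: $\psi^\eta(e,u,v)=\eta(u)^{-1}\psi(e,u,v)\eta(v)$. $\psi/\mathbb F^+$ is $\psi$ composed with the quotient $\Gamma\to\Gamma/\mathbb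 F^+$. Frame matroid $F(G,\varphi)$: circuits are balanced cycles, tight handcuffs (two edge-disjoint cycles sharing exactly one vertex) and loose handcuffs (two vertex-disjoint cycles joined by a minimal path) with both cycles unbalanced, and theta graphs with all cycles unbalanced. Construction: $N=F(G,\psi/\mathbb F^+)$; $\mathcal C$ is the set of circuits $C$ of $N$ that are $\psi$-balanced cycles, or handcuffs or theta graphs with $\psi^\eta(C)\subseteq A$ for some switching $\eta$ and $A\in\mathcal A$; $M(\Gamma,\mathbb F^+,\mathcal A,G,\psi)$ is the matroid on $E(G)$ with rank $r_N(X)$ if every circuit of $N|X$ is in $\mathcal C$, and $r_N(X)+1$ otherwise. An orientation $D$ chooses for each edge one oriented edge $(e,v,w)$. $A(D,\psi)$ is the matrix over $\mathbb F$ with rows indexed by $V(G)\cup\{v_0\}$ ($v_0\notin V(G)$) and columns by $E(G)$: if $e$ is oriented in $D$ from $v$ to $w$ and $\psi(e,v,w)=(a,b)$, the entry in row $u$, column $e$ is $a$ if $u=v_0$; $1$ if $u=v\ne w$; $-b$ if $u=w\ne v$; $1-b$ if $u=v=w$; $0$ otherwise. *)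

(* Defs.v *)
From HB Require Import structures.
From mathcomp Require Import all_boot all_order all_algebra boolp.
From mathcomp Require Import generic_quotient.
Set Implicit Arguments.
Unset Strict Implicit.
Unset Printing Implicit Defensive.
Import GRing.Theory.

Record normalSubgroup (gT : groupType) := NormalSubgroup {
  nsub_pred :> {pred gT};
  nsub1 : 1%g \in nsub_pred;
  nsubM : forall x y, x \in nsub_pred -> y \in nsub_pred ->
    (x * y)%g \in nsub_pred;
  nsubV : forall x, x \in nsub_pred -> (x^-1)%g \in nsub_pred;
  nsubJ : forall x y, x \in nsub_pred -> (x ^ y)%g \in nsub_pred
}.

Section QuotientGroup.
Local Open Scope group_scope.
Local Open Scope quotient_scope.
Variables (gT : groupType) (H : normalSubgroup gT).

Definition coset_eq : rel gT := fun x y => x^-1 * y \in nsub_pred H.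

Lemma coset_eq_refl : reflexive coset_eq.
Proof. by move=> x; rewrite /coset_eq mulVg nsub1. Qed.

Lemma coset_eq_sym : symmetric coset_eq.
Proof.
have h x y : coset_eq x y -> coset_eq y x.
  by rewrite /coset_eq => /nsubV; rewrite invgM invgK.
by move=> x y; apply/idP/idP; apply: h.
Qed.

Lemma coset_eq_trans : transitive coset_eq.
Proof.
move=> y x z xy yz; rewrite /coset_eq.
by have := nsubM xy yz; rewrite mulgA mulgK.
Qed.

Canonical coset_equiv :=
  EquivRel coset_eq coset_eq_refl coset_eq_sym coset_eq_trans.

Definition quotient_group : Type := {eq_quot coset_equiv}.
HB.instance Definition _ := Choice.on quotient_group.
HB.instance Definition _ := EqQuotient.on quotient_group.

Definition quotient_proj (x : gT) : quotient_group := \pi_quotient_group x.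

Definition qone : quotient_group := quotient_proj 1.
Definition qinv (x : quotient_group) := quotient_proj (repr x)^-1.
Definition qmul (x y : quotient_group) := quotient_proj (repr x * repr y).

Lemma quotient_projP x y :
  reflect (quotient_proj x = quotient_proj y) (coset_eq x y).
Proof. by apply: (iffP idP) => [xy|/eqquotP//]; apply/eqquotP. Qed.

Lemma repr_proj x : coset_eq (repr (quotient_proj x)) x.
Proof. by apply/quotient_projP; rewrite /quotient_proj reprK. Qed.

Lemma quotient_projV x : qinv (quotient_proj x) = quotient_proj x^-1.
Proof.
apply/quotient_projP; rewrite /coset_eq invgK.
have := repr_proj x; rewrite coset_eq_sym => /(nsubJ x^-1).
by rewrite /conjg invgK !mulgA mulgV mul1g.
Qed.

Lemma quotient_projM x y :
  qmul (quotient_proj x) (quotient_proj y) = quotient_proj (x * y).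
Proof.
apply/quotient_projP; rewrite /coset_eq invgM.
have := nsubM (nsubJ (repr (quotient_proj y)) (repr_proj x)) (repr_proj y).
by rewrite /conjg !mulgA mulgK.
Qed.

Lemma qmulA : associative qmul.
Proof.
move=> x y z; rewrite -[x]reprK -[y]reprK -[z]reprK.
by rewrite -!/(quotient_proj _) !quotient_projM mulgA.
Qed.

Lemma qmul1g : left_id qone qmul.
Proof. by move=> x; rewrite -[x]reprK -!/(quotient_proj _) quotient_projM mul1g. Qed.

Lemma qmulg1 : right_id qone qmul.
Proof. by move=> x; rewrite -[x]reprK -!/(quotient_proj _) quotient_projM mulg1. Qed.

Lemma qmulVg : left_inverse qone qinv qmul.
Proof.
move=> x; rewrite -[x]reprK -!/(quotient_proj _) quotient_projV.
by rewrite quotient_projM mulVg.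
Qed.

Lemma qmulgV : right_inverse qone qinv qmul.
Proof.
move=> x; rewrite -[x]reprK -!/(quotient_proj _) quotient_projV.
by rewrite quotient_projM mulgV.
Qed.

HB.instance Definition _ := isGroup.Build quotient_group
  qmulA qmul1g qmulg1 qmulVg qmulgV.

End QuotientGroup.

Record multigraph (V E : finType) := Multigraph {
  ends : E -> {set V};
  _ : forall e, 0 < #|ends e| <= 2
}.

(* The triple (e, u, v) stands for the edge e oriented from u to v; only those
   with [is_oriented] are genuine, and a loop has a single orientation. *)
Definition oriented_edge (V E : finType) : Type := (E * V * V)%type.

Section Graphs.
Variables (V E : finType) (G : multigraph V E).
Local Notation oedge := (oriented_edge V E).
Implicit Types (d : oedge) (p : seq oedge) (C P X : {set E}) (u v : V).

Definition edge_of d : E := d.1.1.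
Definition tail d : V := d.1.2.
Definition head d : V := d.2.

Definition is_oriented d := ends G (edge_of d) == [set tail d; head d].

Definition vertices X : {set V} := \bigcup_(e in X) ends G e.

Fixpoint walk u p v : bool :=
  if p is d :: p' then [&& is_oriented d, tail d == u & walk (head d) p' v]
  else u == v.

(* Distinctness of the edges matters for length 2 only. *)
Definition simple_closed_walk p : Prop :=
  [/\ p != [::], exists u, walk u p u, uniq (map tail p)
    & uniq (map edge_of p)].

Definition walk_edges p : {set E} := [set e in map edge_of p].

Definition is_cycle C : Prop :=
  exists2 p, simple_closed_walk p & walk_edges p = C.

Definition is_path u v P : Prop :=
  exists p, [/\ walk u p v, uniq (u :: map head p) & walk_edges p = P].

Definition tight_handcuff C1 C2 C : Prop :=
  [/\ is_cycle C1, is_cycle C2, [disjoint C1 & C2],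
      #|vertices C1 :&: vertices C2| = 1 & C = C1 :|: C2].

Definition joining_path C1 C2 P : Prop :=
  exists u v, [/\ u \in vertices C1, v \in vertices C2 & is_path u v P].

Definition loose_handcuff C1 C2 C : Prop :=
  exists P,
  [/\ is_cycle C1 /\ is_cycle C2, [disjoint vertices C1 & vertices C2],
      joining_path C1 C2 P,
      forall Q, joining_path C1 C2 Q -> Q \subset P -> Q = P
    & C = C1 :|: C2 :|: P].

Definition handcuff C1 C2 C : Prop :=
  tight_handcuff C1 C2 C \/ loose_handcuff C1 C2 C.

Definition is_handcuff C : Prop := exists C1 C2, handcuff C1 C2 C.

Definition is_theta C : Prop :=
  exists u v (P : 'I_3 -> {set E}),
  [/\ u != v, forall i, is_path u v (P i),
      forall i j, i != j -> [disjoint P i & P j],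
      forall i j, i != j -> vertices (P i) :&: vertices (P j) = [set u; v]
    & C = \bigcup_i P i].

Definition is_orientation (D : E -> V * V) : Prop :=
  forall e, is_oriented (e, (D e).1, (D e).2).

Section Gains.
Variable gT : groupType.

Definition is_gain_function (psi : oedge -> gT) : Prop :=
  forall e u v, is_oriented (e, u, v) -> u != v ->
    psi (e, u, v) = ((psi (e, v, u))^-1)%g.

Definition balanced_cycle (psi : oedge -> gT) C : Prop :=
  exists p, [/\ simple_closed_walk p, walk_edges p = C
              & (\prod_(d <- p) psi d)%g = 1%g].

Definition switch (eta : V -> gT) (psi : oedge -> gT) : oedge -> gT :=
  fun d => ((eta (tail d))^-1 * psi d * eta (head d))%g.

Definition frame_circuit (phi : oedge -> gT) C : Prop :=
  [\/ balanced_cycle phi C,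
      exists C1 C2, [/\ handcuff C1 C2 C, ~ balanced_cycle phi C1
                      & ~ balanced_cycle phi C2]
    | is_theta C /\
      forall C', is_cycle C' -> C' \subset C -> ~ balanced_cycle phi C'].

End Gains.

(* Matroids on E are compared through their rank functions; this is the rank
   function of the matroid with the given collection of circuits. *)
Definition circuit_rank (circuit : {set E} -> Prop) X : nat :=
  \max_(I : {set E} |
        (I \subset X) && `[< forall C, circuit C -> ~~ (C \subset I) >]) #|I|.

Section Construction.
Variables (gT : groupType) (H : normalSubgroup gT) (A : {pred gT} -> Prop).
Variable psi : oedge -> gT.

Definition quotient_gain : oedge -> quotient_group H :=
  fun d => quotient_proj H (psi d).

Definition N_circuit : {set E} -> Prop := frame_circuit quotient_gain.
Definition N_rank : {set E} -> nat := circuit_rank N_circuit.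

Definition selected_circuit C : Prop :=
  N_circuit C /\
  (balanced_cycle psi C \/
   (is_handcuff C \/ is_theta C) /\
   exists (eta : V -> gT) (S : {pred gT}), A S /\
     forall d, is_oriented d -> edge_of d \in C -> switch eta psi d \in S).

Definition M_rank X : nat :=
  if `[< forall C, N_circuit C -> C \subset X -> selected_circuit C >]
  then N_rank X else (N_rank X).+1.

End Construction.
End Graphs.

Section AffineGroup.
Local Open Scope ring_scope.
Variable F : fieldType.

Definition affine : Type := {ab : F * F | ab.2 != 0}.
HB.instance Definition _ := Choice.on affine.
Implicit Types x y z : affine.

Definition trans_part x : F := (val x).1.
Definition mult_part x : F := (val x).2.

Lemma mult_part_neq0 x : mult_part x != 0. Proof. by case: x. Qed.

Definition mk_affine (a b : F) (nz : b != 0) : affine :=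
  exist (fun ab : F * F => ab.2 != 0) (a, b) nz.

Definition aff_one : affine := mk_affine 0 (oner_neq0 F).

Lemma aff_mul_subproof x y : mult_part x * mult_part y != 0.
Proof. by rewrite mulf_neq0 ?mult_part_neq0. Qed.

Definition aff_mul x y : affine :=
  mk_affine (trans_part x + mult_part x * trans_part y) (aff_mul_subproof x y).

Lemma aff_inv_subproof x : (mult_part x)^-1 != 0.
Proof. by rewrite invr_neq0 ?mult_part_neq0. Qed.

Definition aff_inv x : affine :=
  mk_affine (- ((mult_part x)^-1 * trans_part x)) (aff_inv_subproof x).

Lemma aff_eq x y :
  trans_part x = trans_part y -> mult_part x = mult_part y -> x = y.
Proof.
case: x y => [[a b] nb] [[c d] nd]; rewrite /trans_part /mult_part /= => ac bd.
by apply/val_inj; rewrite /= ac bd.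
Qed.

Lemma aff_mulA : associative aff_mul.
Proof.
move=> x y z; apply: aff_eq; rewrite /trans_part /mult_part /=.
  by rewrite mulrDr addrA mulrA.
by rewrite mulrA.
Qed.

Lemma aff_mul1g : left_id aff_one aff_mul.
Proof.
by move=> x; apply: aff_eq; rewrite /trans_part /mult_part /= mul1r ?add0r.
Qed.

Lemma aff_mulg1 : right_id aff_one aff_mul.
Proof.
move=> x; apply: aff_eq; rewrite /trans_part /mult_part /=.
  by rewrite mulr0 addr0.
by rewrite mulr1.
Qed.

Lemma aff_mulVg : left_inverse aff_one aff_inv aff_mul.
Proof.
move=> x; apply: aff_eq; rewrite /trans_part /mult_part /=.
  by rewrite addNr.
by rewrite mulVf ?mult_part_neq0.
Qed.

Lemma aff_mulgV : right_inverse aff_one aff_inv aff_mul.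
Proof.
move=> x; apply: aff_eq; rewrite /trans_part /mult_part /=.
  by rewrite mulrN mulrA mulfV ?mult_part_neq0// mul1r subrr.
by rewrite mulfV ?mult_part_neq0.
Qed.

HB.instance Definition _ := isGroup.Build affine
  aff_mulA aff_mul1g aff_mulg1 aff_mulVg aff_mulgV.

Lemma mult_partM x y : mult_part (x * y)%g = mult_part x * mult_part y.
Proof. by []. Qed.

Lemma mult_partV x : mult_part (x^-1)%g = (mult_part x)^-1.
Proof. by []. Qed.

Definition translation_pred : {pred affine} := [pred x | mult_part x == 1].

Lemma translation1 : 1%g \in translation_pred.
Proof. by rewrite inE. Qed.

Lemma translationM x y : x \in translation_pred -> y \in translation_pred ->
  (x * y)%g \in translation_pred.
Proof. by rewrite !inE mult_partM => /eqP-> /eqP->; rewrite mulr1. Qed.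

Lemma translationV x :
  x \in translation_pred -> (x^-1)%g \in translation_pred.
Proof. by rewrite !inE mult_partV => /eqP->; rewrite invr1. Qed.

Lemma translationJ x y :
  x \in translation_pred -> (x ^ y)%g \in translation_pred.
Proof.
rewrite !inE /conjg !mult_partM mult_partV => /eqP->.
by rewrite mul1r mulVf ?mult_part_neq0.
Qed.

Definition translations : normalSubgroup affine :=
  NormalSubgroup translation1 translationM translationV translationJ.

Definition stabilizer (x : F) : {pred affine} :=
  [pred g | trans_part g + mult_part g * x == x].

Definition point_stabilizers (S : {pred affine}) : Prop :=
  exists x : F, S = stabilizer x.

End AffineGroup.

Section Representation.
Local Open Scope ring_scope.
Variables (F : fieldType) (V E : finType).

(* [None] is the extra row v_0. *)
Definition gain_entry (D : E -> V * V) (psi : oriented_edge V E -> affine F)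
    (r : option V) (e : E) : F :=
  let: (v, w) := D e in
  let a := trans_part (psi (e, v, w)) in
  let b := mult_part (psi (e, v, w)) in
  if r is Some u then
    if v == w then (if u == v then 1 - b else 0)
    else if u == v then 1
    else if u == w then - b
    else 0
  else a.

Definition gain_matrix D psi : 'M[F]_(#|{: option V}|, #|E|) :=
  \matrix_(i, j) gain_entry D psi (enum_val i) (enum_val j).

(* Rank function of the vector matroid on E: rank of the columns in X. *)
Definition vector_rank (m : nat) (B : 'M[F]_(m, #|E|)) (X : {set E}) : nat :=
  \rank (colsub (fun j : 'I_#|X| => enum_rank (enum_val j)) B).

Definition represents (m : nat) (B : 'M[F]_(m, #|E|)) (r : {set E} -> nat) :=
  forall X : {set E}, vector_rank B X = r X.

End Representation.

(* Main.v *)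
Require Import Defs.
From mathcomp Require Import all_boot all_order all_algebra boolp zify.
(* Makes [head] denote the head of an oriented edge rather than [seq.head]. *)
Import Defs.
Set Implicit Arguments.
Unset Strict Implicit.
Unset Printing Implicit Defensive.
Import GRing.Theory.

(** Delete the row [v_0] from [A(D,psi)].  What remains represents [N]:
    handcuffs and thetas have more edges than vertices and a balanced cycle has
    a nonzero left kernel vector, so circuits of [N] are dependent; conversely,
    at every vertex the support of a linear dependency has at least two edges,
    unless it contains a balanced loop, so following edges outside an unbalanced
    cycle closes up into a handcuff or a theta.  Restoring the row [v_0] raises
    the rank of the columns [X] unless that row, restricted to [X], is spanned
    by the others.  By circuit elimination this can be tested on the circuits
    [C] of [N] inside [X], where spanning means that there is a potential
    [y : V -> F] with [psi(e,v,w)] mapping [y w] to [y v] along [C].  Such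
    potentials are the switchings that put the gains into a point stabilizer,
    and on a cycle whose gain is a translation a potential forces that gain to
    be the identity. *)

Section RowSpaces.
Local Open Scope ring_scope.
Variable F : fieldType.

Lemma mxrank_lt_colP m n (M : 'M[F]_(m, n)) :
  (\rank M < n)%N <-> exists2 u : 'cV_n, u != 0 & M *m u = 0.
Proof.
have -> : (\rank M < n)%N = (kermx M^T != 0).
  by rewrite kermx_eq0 /row_free mxrank_tr ltn_neqAle rank_leq_col andbT.
split=> [/rowV0Pn [u /sub_kermxP uM u0]|[u u0 Mu]].
  by exists u^T; rewrite ?trmx_eq0 // -[M]trmxK -trmx_mul uM trmx0.
apply/rowV0Pn; exists u^T; last by rewrite trmx_eq0.
by apply/sub_kermxP; rewrite -trmx_mul Mu trmx0.
Qed.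

Lemma submx_colP k m n (A : 'M[F]_(k, n)) (M : 'M[F]_(m, n)) :
  (A <= M)%MS <-> forall u : 'cV_n, M *m u = 0 -> A *m u = 0.
Proof.
split=> [/submxP [B ->] u Mu|orthA]; first by rewrite -mulmxA Mu mulmx0.
rewrite submxE; apply/eqP/matrixP => i j.
have : A *m col j (cokermx M) = 0.
  by apply: orthA; rewrite colE mulmxA mulmx_coker mul0mx.
by move/matrixP/(_ i 0); rewrite colE mulmxA -colE !mxE.
Qed.

Lemma mxrank_adds_row m n (M : 'M[F]_(m, n)) (a : 'rV_n) :
  \rank (M + a)%MS = (\rank M + ~~ (a <= M)%MS)%N.
Proof.
have [aM|aM] := boolP (a <= M)%MS; first by rewrite (addsmx_idPl aM) addn0.
apply/eqP; rewrite eqn_leq addn1 rank_ltmx ?andbT; last first.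
  by rewrite ltmxE addsmxSl addsmx_sub submx_refl.
apply: leq_trans (mxrank_adds_leqif _ _) _.
by rewrite -[leqRHS]addn1 leq_add2l rank_leq_row.
Qed.

End RowSpaces.

Section IndexedMatrices.
Local Open Scope ring_scope.
Variable F : fieldType.
Implicit Types R E : finType.

Definition restrict E (X : {pred E}) (a : E -> F) : 'rV[F]_#|X| :=
  \row_j a (enum_val j).

Definition submat R E (f : R -> E -> F) (W : {pred R}) (X : {pred E}) :
    'M[F]_(#|W|, #|X|) :=
  \matrix_(i, j) f (enum_val i) (enum_val j).

Lemma row_submat R E (f : R -> E -> F) W X i :
  row i (submat f W X) = restrict X (f (enum_val i)).
Proof. by apply/rowP => j; rewrite !mxE. Qed.

Lemma trmx_submat R E (f : R -> E -> F) W X :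
  (submat f W X)^T = submat (fun e v => f v e) X W.
Proof. by apply/matrixP => i j; rewrite !mxE. Qed.

Lemma restrict_submat R E (f : R -> E -> F) (W : {pred R}) X v :
  v \in W -> (restrict X (f v) <= submat f W X)%MS.
Proof.
move=> vW; apply: (eq_row_sub (enum_rank_in vW v)).
by rewrite row_submat enum_rankK_in.
Qed.

Lemma submat_subP R E (f : R -> E -> F) (W : {pred R}) X m (M : 'M_(m, #|X|)) :
  reflect (forall v, v \in W -> (restrict X (f v) <= M)%MS)
    (submat f W X <= M)%MS.
Proof.
apply: (iffP idP) => [fM v vW|fM].
  exact: submx_trans (restrict_submat f X vW) fM.
by apply/row_subP => i; rewrite row_submat fM ?enum_valP.
Qed.

Lemma mxrank_submatS R E (f : R -> E -> F) (W : {pred R}) (X Y : {pred E}) :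
  X \subset Y -> (\rank (submat f W X) <= \rank (submat f W Y))%N.
Proof.
move=> /subsetP XY; rewrite -mxrank_tr -[leqRHS]mxrank_tr !trmx_submat.
apply/mxrankS/submat_subP => e /XY eY.
exact: (restrict_submat (fun e v => f v e)).
Qed.

Lemma exists_column_basis R E (f : R -> E -> F) (W : {pred R}) (X : {set E}) :
  exists I : {set E}, [/\ I \subset X, \rank (submat f W I) = #|I|
    & \rank (submat f W X) = #|I|].
Proof.
pose M := submat (fun e v => f v e) X W.
pose g i := enum_val (maxrankfun M i); pose I := [set g i | i in 'I_(\rank M)].
have cardI : #|I| = \rank M.
  by rewrite card_imset ?card_ord // => i j /enum_val_inj /maxrankfun_inj.
have rankM : \rank (submat f W X) = \rank M by rewrite -mxrank_tr trmx_submat.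
exists I; rewrite rankM; split=> //.
  by apply/subsetP => _ /imsetP [i _ ->]; apply: enum_valP.
apply/eqP; rewrite eqn_leq rank_leq_col [leqLHS]cardI -[leqRHS]mxrank_tr.
rewrite trmx_submat -(eq_maxrowsub M); apply/mxrankS/row_subP => i.
rewrite row_rowsub row_submat.
by apply: (restrict_submat (fun e v => f v e)); apply: imset_f.
Qed.

Lemma vector_rank_submat R E (f : R -> E -> F) (X : {set E}) :
  vector_rank (submat f R E) X = \rank (submat f R X).
Proof. by congr mxrank; apply/matrixP => i j; rewrite !mxE enum_rankK. Qed.

End IndexedMatrices.

Section ColumnRelations.
Local Open Scope ring_scope.
Variable F : fieldType.
Implicit Types R E : finType.

Definition column_relation R E (f : R -> E -> F) (W : {pred R}) (z : E -> F) :
    Prop :=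
  forall v, v \in W -> \sum_e f v e * z e = 0.

Definition dependent R E (f : R -> E -> F) (W : {pred R}) (X : {pred E}) :
    Prop :=
  exists z : E -> F,
    [/\ exists e, z e != 0, support z \subset X & column_relation f W z].

Definition row_spanned R E (f : R -> E -> F) (X : {pred E}) (a : E -> F) :
    Prop :=
  exists y : R -> F, forall e, e \in X -> a e = \sum_v f v e * y v.

Lemma notin_support E (z : E -> F) (X : {pred E}) e :
  support z \subset X -> e \notin X -> z e = 0.
Proof. by move=> /subsetP zX; apply: contraNeq => ze; apply: zX. Qed.

Lemma sum_support E (z : E -> F) (X : {pred E}) (a : E -> F) :
  support z \subset X -> \sum_(e in X) a e * z e = \sum_e a e * z e.
Proof.
by move=> zX; apply: big_rmcond => e eX; rewrite (notin_support zX) ?mulr0.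
Qed.

Lemma mulmx_restrict E (X : {pred E}) (a z : E -> F) : support z \subset X ->
  restrict X a *m (restrict X z)^T = (\sum_e a e * z e)%:M.
Proof.
move=> zX; apply/matrixP => i j; rewrite !ord1 !mxE eqxx mulr1n.
rewrite -(sum_support _ zX) [RHS]big_enum_val.
by apply: eq_bigr => k _; rewrite !mxE.
Qed.

Lemma column_relationP R E (f : R -> E -> F) W X z : support z \subset X ->
  column_relation f W z <-> submat f W X *m (restrict X z)^T = 0.
Proof.
move=> zX; have rowE i : row i (submat f W X *m (restrict X z)^T) =
    (\sum_e f (enum_val i) e * z e)%:M.
  by rewrite row_mul row_submat mulmx_restrict.
split=> [fz|fz v vW].
  by apply/row_matrixP => i; rewrite rowE fz ?enum_valP // row0 raddf0.
have := rowE (enum_rank_in vW v); rewrite fz row0 enum_rankK_in //.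
by move/matrixP/(_ 0 0); rewrite !mxE.
Qed.

Lemma restrict_surj E (X : {pred E}) (u : 'rV[F]_#|X|) :
  exists2 z : E -> F, support z \subset X & restrict X z = u.
Proof.
exists (fun e => \sum_(j | enum_val j == e) u 0 j).
  apply/subsetP => e; apply: contraR => eX; rewrite big1 // => j /eqP jX.
  by rewrite -jX enum_valP in eX.
apply/rowP => j; rewrite mxE (big_pred1 j) // => k.
by rewrite /= (inj_eq enum_val_inj).
Qed.

Lemma restrict_neq0 E (X : {pred E}) (z : E -> F) : support z \subset X ->
  restrict X z != 0 <-> exists e, z e != 0.
Proof.
move=> /subsetP zX; split=> [/rV0Pn [j]|[e ze]].
  by rewrite mxE => zj; exists (enum_val j).
apply/rV0Pn; exists (enum_rank_in (zX e ze) e).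
by rewrite mxE enum_rankK_in ?zX.
Qed.

Lemma dependentP R E (f : R -> E -> F) W X :
  dependent f W X <-> (\rank (submat f W X) < #|X|)%N.
Proof.
rewrite mxrank_lt_colP; split=> [[z [nz zX fz]]|[u u0 fu]].
  exists (restrict X z)^T; last by apply/column_relationP.
  by rewrite trmx_eq0; apply/restrict_neq0.
have [z zX zu] := restrict_surj u^T; exists z; split=> //.
  by apply/(restrict_neq0 zX); rewrite zu trmx_eq0.
by apply/(column_relationP _ _ zX); rewrite zu trmxK.
Qed.

Lemma dependentS R E (f : R -> E -> F) W (X Y : {pred E}) :
  X \subset Y -> dependent f W X -> dependent f W Y.
Proof.
by move=> XY [z [nz zX fz]]; exists z; split=> //; apply: subset_trans XY.
Qed.

Lemma dependent_rows R E (f : R -> E -> F) (W : {pred R}) (X : {pred E}) :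
  (forall v e, e \in X -> v \notin W -> f v e = 0) ->
  dependent f W X <-> dependent f R X.
Proof.
move=> f0; split=> -[z [nz zX fz]]; exists z; split=> // v; last first.
  by move=> _; apply: fz.
have [/fz//|vW _] := boolP (v \in W).
by rewrite -(sum_support _ zX) big1 // => e eX; rewrite f0 ?mul0r.
Qed.

Lemma dependent_card R E (f : R -> E -> F) (W : {pred R}) X :
  (#|W| < #|X|)%N -> dependent f W X.
Proof.
by move=> WX; apply/dependentP; apply: leq_ltn_trans (rank_leq_row _) WX.
Qed.

Lemma dependent_tr R E (f : R -> E -> F) (W : {pred R}) X : #|W| = #|X| ->
  dependent f W X <-> dependent (fun e v => f v e) X W.
Proof.
move=> WX; rewrite !dependentP [X in _ <-> (_ < X)%N]WX.
by rewrite -trmx_submat mxrank_tr.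
Qed.

Lemma row_spannedP R E (f : R -> E -> F) (X : {pred E}) a :
  row_spanned f X a <-> (restrict X a <= submat f R X)%MS.
Proof.
split=> [[y fy]|/submxP [B aB]].
  apply/submxP; exists (restrict R y); apply/rowP => j.
  rewrite !mxE fy ?enum_valP // [LHS]big_enum_val.
  by apply: eq_bigr => i _; rewrite !mxE mulrC.
exists (fun v => B 0 (enum_rank v)) => e eX.
move/rowP/(_ (enum_rank_in eX e)): aB; rewrite !mxE enum_rankK_in // => ->.
rewrite [RHS]big_enum_val; apply: eq_bigr => i _.
by rewrite !mxE enum_rankK_in // enum_valK mulrC.
Qed.

Lemma row_spanned_orthP R E (f : R -> E -> F) (X : {pred E}) a :
  row_spanned f X a <->
  forall z, support z \subset X -> column_relation f R z ->
    \sum_e a e * z e = 0.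
Proof.
rewrite row_spannedP submx_colP; split=> [orth z zX fz|orth u fu].
  have /matrixP/(_ 0 0) := orth _ ((column_relationP _ _ zX).1 fz).
  by rewrite mulmx_restrict // !mxE.
have [z zX zu] := restrict_surj u^T.
rewrite -[u]trmxK -zu mulmx_restrict // orth ?raddf0 //.
by apply/(column_relationP _ _ zX); rewrite zu trmxK.
Qed.

End ColumnRelations.

Section CircuitDetection.
Local Open Scope ring_scope.
Variables (F : fieldType) (R E : finType).
Variables (f : R -> E -> F) (circuit : {set E} -> Prop).

Definition detects_dependence : Prop :=
  (forall C, circuit C -> dependent f R C) /\
  (forall X : {set E}, dependent f R X -> exists2 C, circuit C & C \subset X).

Hypothesis f_detected : detects_dependence.

Lemma represents_circuit_rank :
  represents (submat f R E) (circuit_rank circuit).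
Proof.
have [circ_dep dep_circ] := f_detected.
have freeP (I : {set E}) : reflect (\rank (submat f R I) = #|I|)
    `[< forall C, circuit C -> ~~ (C \subset I) >].
  apply: (iffP (asboolP _)) => [free|rankI C /circ_dep depC].
    apply/eqP; rewrite eqn_leq rank_leq_col leqNgt /=; apply/negP.
    by move=> /dependentP /dep_circ [C /free /negP].
  by apply/negP => /dependentS /(_ depC) /dependentP; rewrite rankI ltnn.
move=> X; rewrite vector_rank_submat.
have [I [IX rankI rankX]] := exists_column_basis f R X.
apply/eqP; rewrite eqn_leq; apply/andP; split; last first.
  by apply/bigmax_leqP => J /andP [JX /freeP <-]; apply: mxrank_submatS.
rewrite rankX; apply: (leq_bigmax_cond (F := fun I : {set E} => #|I|)).
by rewrite IX; apply/freeP.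
Qed.

(* A relation [t] on a circuit inside the support of [z] that is orthogonal to
   [a] can be subtracted from [z], which shrinks the support of [z] without
   changing its product with [a]. *)
Lemma exists_unspanned_circuit (a z : E -> F) :
  column_relation f R z -> \sum_e a e * z e != 0 ->
  exists C, [/\ circuit C, C \subset support z & ~ row_spanned f C a].
Proof.
have [circ_dep dep_circ] := f_detected.
have [n] := ubnP #|support z|; elim: n z => // n IH z le_n fz az.
have [|C circC /subsetP Cz] := dep_circ [set e in support z].
  exists z; split=> //; last by apply/subsetP => e ze; rewrite inE.
  apply/existsP; apply: contraNT az => /existsPn z0; rewrite big1 // => e _.
  by have /negPn/eqP -> := z0 e; rewrite mulr0.
have {}Cz : C \subset support z by apply/subsetP => e /Cz; rewrite inE.
have [spanC|] := pselect (row_spanned f C a); last by exists C.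
have [t [[e0 te0] tC ft]] := circ_dep C circC.
have at0 := (row_spanned_orthP f C a).1 spanC t tC ft.
have e0z : e0 \in support z by apply/(subsetP Cz)/(subsetP tC).
pose w e := z e - z e0 / t e0 * t e.
have sum_w h : \sum_e h e * t e = 0 -> \sum_e h e * w e = \sum_e h e * z e.
  move=> ht; under eq_bigr do rewrite /w mulrBr mulrCA.
  by rewrite sumrB -mulr_sumr ht mulr0 subr0.
have wz : support w \proper support z.
  apply/properP; split; last by exists e0; rewrite // negbK /w divfK ?subrr.
  apply/subsetP => e; apply: contraLR => ez; rewrite negbK /w.
  rewrite (notin_support (subxx _) ez) (notin_support (subset_trans tC Cz) ez).
  by rewrite mulr0 subrr.
have [|v vR||C' [circC' C'w spanC']] := IH w.
- exact: leq_trans (proper_card wz) _.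
- by rewrite sum_w ?fz ?ft.
- by rewrite sum_w.
by exists C'; split=> //; apply: subset_trans C'w (proper_sub wz).
Qed.

Lemma row_spanned_circuits (X : {set E}) (a : E -> F) :
  row_spanned f X a <-> forall C, circuit C -> C \subset X -> row_spanned f C a.
Proof.
split=> [[y fy] C _ /subsetP CX|spanC]; first by exists y => e /CX; apply: fy.
apply/row_spanned_orthP => z zX fz; apply: contrapT => /eqP az.
have [C [circC Cz]] := exists_unspanned_circuit fz az.
by apply; apply: spanC; last exact: subset_trans zX.
Qed.

End CircuitDetection.

Section ExtraRow.
Local Open Scope ring_scope.
Variables (F : fieldType) (R E : finType) (f : option R -> E -> F).

Definition lower_rows (v : R) : E -> F := f (Some v).

Lemma submat_extra_row (X : {set E}) :
  (submat f {: option R} X :=: submat lower_rows R X + restrict X (f None))%MS.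
Proof.
apply/eqmxP/andP; split.
  apply/submat_subP => -[v|] _; last exact: addsmxSr.
  by apply: submx_trans (addsmxSl _ _); apply: (restrict_submat lower_rows).
rewrite addsmx_sub restrict_submat // andbT; apply/submat_subP => v _.
exact: restrict_submat.
Qed.

Lemma represents_extra_row (circuit : {set E} -> Prop) :
  detects_dependence lower_rows circuit ->
  represents (submat f {: option R} E) (fun X =>
    if `[< forall C, circuit C -> C \subset X ->
             row_spanned lower_rows C (f None) >]
    then circuit_rank circuit X else (circuit_rank circuit X).+1).
Proof.
move=> circP X; rewrite vector_rank_submat submat_extra_row mxrank_adds_row.
rewrite -vector_rank_submat (represents_circuit_rank circP).
set spanX := (_ <= _)%MS; set spanC := `[< _ >].
suff <- : spanX = spanC by case: spanX; rewrite ?addn0 ?addn1.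
apply/idP/asboolP => [/row_spannedP|] spanned.
  by apply/(row_spanned_circuits circP).
by apply/row_spannedP/(row_spanned_circuits circP).
Qed.

End ExtraRow.

Section Walks.
Variables (V E : finType) (G : multigraph V E).
Local Notation oedge := (oriented_edge V E).
Local Notation tails := (map (@tail V E)).
Local Notation heads := (map (@head V E)).
Local Notation edges := (map (@edge_of V E)).
Implicit Types (d : oedge) (p q : seq oedge) (C P X Y : {set E}) (u v w x : V).

Lemma ends_neq0 e : ends G e != set0.
Proof.
by rewrite -card_gt0; case: G => ends' ends_le2 /=; case/andP: (ends_le2 e).
Qed.

Lemma ends_oriented d :
  is_oriented G d -> ends G (edge_of d) = [set tail d; head d].
Proof. by move/eqP. Qed.

Lemma orientation_from e x : x \in ends G e ->
  exists d, [/\ is_oriented G d, edge_of d = e & tail d = x].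
Proof.
case: G => ends' ends_le2 /= xe.
suff [y xy] : exists y, ends' e = [set x; y].
  by exists (e, x, y); split=> //; rewrite /is_oriented /= xy.
rewrite -(setD1K xe); have /andP [_] := ends_le2 e.
rewrite (cardsD1 x) xe ltnS leq_eqVlt ltnS leqn0.
case/orP=> [/cards1P [y ->]|/eqP/cards0_eq ->]; first by exists y.
by exists x; rewrite setU0 setUid.
Qed.

Definition flip d : oedge := (edge_of d, head d, tail d).

Lemma flip_oriented d : is_oriented G (flip d) = is_oriented G d.
Proof. by rewrite /is_oriented /flip /edge_of /tail /head /= setUC. Qed.

Lemma oriented_eqVflip d d' : is_oriented G d -> is_oriented G d' ->
  edge_of d' = edge_of d -> d' = d \/ d' = flip d.
Proof.
case: d d' => [[e t] h] [[e' t'] h'].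
rewrite /is_oriented /flip /edge_of /tail /head /=.
move=> /eqP ends_e /eqP ends_e' ee'; move: ends_e'; rewrite ee' ends_e => th.
have tt' : t \in [set t'; h'] by rewrite -th set21.
have hh' : h \in [set t'; h'] by rewrite -th set22.
have: t' \in [set t; h] by rewrite th set21.
have: h' \in [set t; h] by rewrite th set22.
move: tt' hh'; rewrite !inE.
by do 4![case/pred2P=> ?]; subst; auto.
Qed.

Lemma verticesU X Y : vertices G (X :|: Y) = vertices G X :|: vertices G Y.
Proof. exact: bigcup_setU. Qed.

Lemma vertices1 e : vertices G [set e] = ends G e.
Proof. exact: big_set1. Qed.

Lemma verticesS X Y : X \subset Y -> vertices G X \subset vertices G Y.
Proof. by move=> /setUidPr <-; rewrite verticesU subsetUl. Qed.

Lemma mem_vertices e X x : e \in X -> x \in ends G e -> x \in vertices G X.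
Proof. by move=> eX xe; apply/bigcupP; exists e. Qed.

Lemma disjoint_vertices X Y :
  [disjoint vertices G X & vertices G Y] -> [disjoint X & Y].
Proof.
rewrite -!setI_eq0; apply: contraTT => /set0Pn [e /setIP [eX eY]].
have /set0Pn [x xe] := ends_neq0 e.
by apply/set0Pn; exists x; rewrite inE !(mem_vertices _ xe).
Qed.

Lemma walk_cat u p q v :
  walk G u (p ++ q) v <-> exists2 w, walk G u p w & walk G w q v.
Proof.
elim: p u => [|d p IH] u /=.
  by split=> [|[w /eqP->]] //; exists u.
split=> [/and3P [-> -> /IH [w pw qw]]|[w /and3P [-> -> pw] qw]].
  by exists w.
by rewrite /=; apply/IH; exists w.
Qed.

Lemma walk_rcons u p d v :
  walk G u (rcons p d) v =
  [&& walk G u p (tail d), is_oriented G d & head d == v].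
Proof.
elim: p u => [|d' p IH] u /=; last by rewrite IH !andbA.
by rewrite [tail d == u]eq_sym andbCA.
Qed.

Lemma walk_heads u p v : walk G u p v -> u :: heads p = rcons (tails p) v.
Proof.
elim: p u => [|d p IH] u /=; first by move=> /eqP->.
by move=> /and3P [_ /eqP-> /IH ->].
Qed.

Lemma walk_oriented u p v d : walk G u p v -> d \in p -> is_oriented G d.
Proof.
elim: p u => [|d' p IH] u //= /and3P [od _ pw].
by rewrite inE => /predU1P [->|/(IH _ pw)].
Qed.

Lemma walk_split u p v x : walk G u p v -> x \in tails p ->
  exists p1 d p2, [/\ p = p1 ++ d :: p2, walk G u p1 x & walk G x (d :: p2) v].
Proof.
move=> pw /mapP [d dp ->]; case/splitPr: dp pw => p1 p2 /walk_cat [w w1 w2].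
by exists p1, d, p2; split=> //; case/and3P: w2 (w2) w1 => _ /eqP->.
Qed.

Lemma walk_rev u p v : walk G u p v -> walk G v (rev (map flip p)) u.
Proof.
elim: p u => [|d p IH] u /=; first by rewrite eq_sym.
move=> /and3P [od /eqP tu /IH pw].
by rewrite rev_cons walk_rcons flip_oriented od pw /= -tu.
Qed.

Lemma walk_edges_nil : walk_edges ([::] : seq oedge) = set0.
Proof. by apply/setP => e; rewrite !inE. Qed.

Lemma walk_edges_cons d p : walk_edges (d :: p) = edge_of d |: walk_edges p.
Proof. by apply/setP => e; rewrite !inE. Qed.

Lemma walk_edges_cat p q : walk_edges (p ++ q) = walk_edges p :|: walk_edges q.
Proof. by apply/setP => e; rewrite !inE map_cat mem_cat. Qed.

Lemma walk_edges_rcons p d : walk_edges (rcons p d) = edge_of d |: walk_edges p.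
Proof.
by rewrite -cats1 walk_edges_cat walk_edges_cons walk_edges_nil setU0 setUC.
Qed.

Lemma walk_edges_rev p : walk_edges (rev (map flip p)) = walk_edges p.
Proof. by apply/setP => e; rewrite !inE map_rev mem_rev -map_comp. Qed.

Lemma card_walk_edges p : uniq (edges p) -> #|walk_edges p| = size p.
Proof. by move=> up; rewrite /walk_edges cardsE (card_uniqP up) size_map. Qed.

Lemma mem_vertices_walk u p v x : walk G u p v ->
  (x \in vertices G (walk_edges p)) = (x \in tails p) || (x \in heads p).
Proof.
elim: p u => [|d p IH] u.
  by rewrite walk_edges_nil /vertices big_set0 inE.
rewrite /= => /and3P [od _ /IH xp].
rewrite walk_edges_cons verticesU vertices1 (ends_oriented od) !inE xp.
by rewrite -!orbA; congr (_ || _); rewrite orbCA.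
Qed.

Lemma mem_vertices_open_walk u p v x : walk G u p v -> p != [::] ->
  (x \in vertices G (walk_edges p)) = (x \in u :: heads p).
Proof.
move=> pw; rewrite (mem_vertices_walk _ pw).
case: p pw => // d p /= /and3P [_ /eqP <- /walk_heads headsE] _.
rewrite headsE !in_cons mem_rcons in_cons -orbA; congr (_ || _).
by rewrite orbCA orbb.
Qed.

Lemma mem_vertices_closed_walk u p x : walk G u p u ->
  (x \in vertices G (walk_edges p)) = (x \in tails p).
Proof.
move=> pw; rewrite (mem_vertices_walk _ pw).
case: p pw => // d p /= /and3P [_ /eqP <- /walk_heads headsE].
by rewrite headsE mem_rcons orbb.
Qed.

Lemma mem_tails_start u p v : walk G u p v -> p != [::] -> u \in tails p.
Proof. by case: p => // d p /= /and3P [_ /eqP-> _] _; rewrite mem_head. Qed.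

Lemma neq_walk_nonempty u p v : walk G u p v -> u != v -> p != [::].
Proof. by case: p => //= ->. Qed.

Lemma path_uniq_edges u p v :
  walk G u p v -> uniq (u :: heads p) -> uniq (edges p).
Proof.
elim: p u => //= d p IH u /and3P [od /eqP tu pw] /and3P [u_fresh hd up].
rewrite (IH _ pw) ?andbT /= ?hd //; apply/negP => dp.
have : u \in vertices G (walk_edges p).
  apply: (mem_vertices (e := edge_of d)); first by rewrite inE.
  by rewrite (ends_oriented od) tu set21.
rewrite (mem_vertices_open_walk _ pw) ?(negPf u_fresh) //.
by case: (p) dp.
Qed.

Lemma cycle_walk_from C x : is_cycle G C -> x \in vertices G C ->
  exists p, [/\ walk G x p x, simple_closed_walk G p & walk_edges p = C].
Proof.
move=> [p [_ [u pw] ut ue] <-]; rewrite (mem_vertices_closed_walk _ pw) => xp.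
have [p1 [d [p2 [pE w1 w2]]]] := walk_split pw xp.
have pw' : walk G x ((d :: p2) ++ p1) x by apply/walk_cat; exists u.
exists ((d :: p2) ++ p1); split=> //; last by rewrite pE !walk_edges_cat setUC.
split=> //; first by exists x.
  by rewrite map_cat uniq_catC -map_cat -pE.
by rewrite map_cat uniq_catC -map_cat -pE.
Qed.

Lemma card_vertices_cycle C : is_cycle G C -> #|vertices G C| = #|C|.
Proof.
move=> [p [_ [u pw] ut ue] <-]; rewrite card_walk_edges //.
rewrite -(size_map (@tail V E)) -(card_uniqP ut); apply: eq_card => x.
by rewrite (mem_vertices_closed_walk _ pw).
Qed.

Lemma cycle_neq0 C : is_cycle G C -> C != set0.
Proof.
move=> [p [p0 _ _ ue] <-].
by rewrite -card_gt0 card_walk_edges // lt0n size_eq0.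
Qed.

Lemma is_path_sym u v P : is_path G u v P -> is_path G v u P.
Proof.
move=> [p [pw up <-]]; exists (rev (map flip p)).
split; [exact: walk_rev | | exact: walk_edges_rev].
rewrite -map_rev -map_comp -[map _ _]/(tails _) map_rev.
by rewrite -rev_rcons -(walk_heads pw) rev_uniq.
Qed.

Lemma is_path_split u v P e : is_path G u v P -> e \in P ->
  exists x y P1 P2,
    [/\ ends G e = [set x; y], is_path G u x P1, is_path G y v P2,
        P1 \subset P :\ e & P2 \subset P :\ e].
Proof.
move=> [p [pw up <-]]; rewrite inE => /mapP [d dp ->].
case/splitPr: dp pw up => p1 p2 pw up.
have := path_uniq_edges pw up.
rewrite map_cat cat_uniq => /and3P [_ d1 /andP [d2 _]].
have /walk_cat [w w1 /and3P [od /eqP tw w2]] := pw; rewrite -tw in w1.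
move: up; rewrite map_cat -cat_cons cat_uniq => /and3P [up1 _ up2].
exists (tail d), (head d), (walk_edges p1), (walk_edges p2); split.
- exact: ends_oriented.
- by exists p1.
- by exists p2.
- rewrite subsetD1 walk_edges_cat subsetUl inE.
  by apply: contra d1 => dp1; apply/hasP; exists (edge_of d); rewrite ?mem_head.
by rewrite subsetD1 inE d2 walk_edges_cat walk_edges_cons setUA subsetUr.
Qed.

Lemma card_vertices_path u v P : is_path G u v P -> u != v ->
  #|vertices G P| <= #|P|.+1.
Proof.
move=> [p [pw up <-]] uv; rewrite (card_walk_edges (path_uniq_edges pw up)).
have <- : #|u :: heads p| = (size p).+1 by rewrite (card_uniqP up) /= size_map.
apply/subset_leq_card/subsetP => x.
by rewrite (mem_vertices_open_walk _ pw) // (neq_walk_nonempty pw uv).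
Qed.

Lemma card_vertices_ear X u v P : is_path G u v P -> u != v ->
  u \in vertices G X -> v \in vertices G X ->
  #|vertices G (X :|: P)| < #|vertices G X| + #|P|.
Proof.
move=> [p [pw up <-]] uv uX vX.
rewrite (card_walk_edges (path_uniq_edges pw up)).
have p0 := neq_walk_nonempty pw uv.
have new_vertices : vertices G (X :|: walk_edges p) \subset
    vertices G X :|: [set x in behead (tails p)].
  rewrite verticesU subUset subsetUl /=; apply/subsetP => x.
  rewrite (mem_vertices_open_walk _ pw) // (walk_heads pw) mem_rcons !inE.
  case: (p) p0 pw => //= d p' _ /and3P [_ /eqP -> _].
  by rewrite inE => /or3P [/eqP->|/eqP->|->]; rewrite ?uX ?vX ?orbT.
apply: leq_ltn_trans (subset_leq_card new_vertices) _.
apply: leq_ltn_trans (leq_card_setU _ _) _; rewrite ltn_add2l cardsE.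
apply: leq_ltn_trans (card_size _) _.
by rewrite size_behead size_map prednK // lt0n size_eq0.
Qed.

End Walks.

Section CircuitCards.
Variables (V E : finType) (G : multigraph V E).
Implicit Types (C P Q : {set E}).

Lemma minimal_joining_path_disjoint C1 C2 P : joining_path G C1 C2 P ->
  (forall Q, joining_path G C1 C2 Q -> Q \subset P -> Q = P) ->
  [disjoint C1 :|: C2 & P].
Proof.
move=> [u [v [uC1 vC2 pathP]]] minP; rewrite -setI_eq0; apply/set0Pn => -[e].
case/setIP => eC eP.
have [x [y [P1 [P2 [xy path1 path2 P1e P2e]]]]] := is_path_split pathP eP.
have not_joining Q : Q \subset P :\ e -> ~ joining_path G C1 C2 Q.
  by rewrite subsetD1 => /andP [QP /negP eQ] /minP/(_ QP) QE; rewrite QE in eQ.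
case/setUP: eC => eC.
  apply: (not_joining P2) => //; exists y, v; split=> //.
  by apply: mem_vertices eC _; rewrite xy set22.
apply: (not_joining P1) => //; exists u, x; split=> //.
by apply: mem_vertices eC _; rewrite xy set21.
Qed.

Lemma card_vertices_loose_handcuff C1 C2 C :
  loose_handcuff G C1 C2 C -> #|vertices G C| < #|C|.
Proof.
move=> [P [[cyc1 cyc2] disjV joinP minP ->]].
have disjP := minimal_joining_path_disjoint joinP minP.
have [u [v [uC1 vC2 pathP]]] := joinP.
have uv : u != v by apply: contraTneq vC2 => <-; rewrite (disjointFr disjV).
rewrite [ltnRHS]cardsU (disjoint_setI0 disjP) cards0 subn0.
apply: leq_trans (card_vertices_ear pathP uv _ _) _.
- by rewrite verticesU inE uC1.
- by rewrite verticesU inE vC2 orbT.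
rewrite leq_add2r verticesU !cardsU (disjoint_setI0 disjV).
rewrite (disjoint_setI0 (disjoint_vertices disjV)) !cards0.
by rewrite !card_vertices_cycle.
Qed.

Lemma card_vertices_handcuff C : is_handcuff G C -> #|vertices G C| < #|C|.
Proof.
move=> [C1 [C2 [[cyc1 cyc2 disjE cardV ->]|]]]; last first.
  exact: card_vertices_loose_handcuff.
rewrite verticesU !cardsU cardV disjoint_setI0 // cards0 subn0.
rewrite !card_vertices_cycle //.
by rewrite subn1 prednK // addn_gt0 card_gt0 (cycle_neq0 cyc1).
Qed.

Lemma card_vertices_theta C : is_theta G C -> #|vertices G C| < #|C|.
Proof.
move=> [u [v [P [uv pathP disjP verticesP ->]]]].
rewrite !big_ord_recl big_ord0 /= setU0 setUA.
set i := ord0; set j := lift _ _; set k := lift _ _.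
have uvV l : [set u; v] \subset vertices G (P l).
  have [m lm] : exists m : 'I_3, l != m.
    by have [l0|] := eqVneq l i; [exists j; rewrite l0|exists i].
  by rewrite -(verticesP _ _ lm) subsetIl.
have [ui vi] : u \in vertices G (P i) /\ v \in vertices G (P i).
  by apply/andP; rewrite -!sub1set -subUset.
have card_ij := card_vertices_ear (pathP j) uv ui vi.
have card_ijk : #|vertices G (P i :|: P j :|: P k)| <
    #|vertices G (P i :|: P j)| + #|P k|.
  by apply: (card_vertices_ear (pathP k) uv); rewrite verticesU inE ?ui ?vi.
have cardE : #|P i :|: P j :|: P k| = #|P i| + #|P j| + #|P k|.
  rewrite !cardsU setIUl (disjoint_setI0 (disjP i j _)) //.
  rewrite (disjoint_setI0 (disjP i k _)) // (disjoint_setI0 (disjP j k _)) //.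
  by rewrite setU0 cards0 !subn0.
have := card_vertices_path (pathP i) uv.
rewrite cardE; lia.
Qed.

End CircuitCards.

Section BicyclicSubgraphs.
Variables (V E : finType) (G : multigraph V E).
Local Notation oedge := (oriented_edge V E).
Local Notation tails := (map (@tail V E)).
Local Notation heads := (map (@head V E)).
Local Notation edges := (map (@edge_of V E)).
Implicit Types (d : oedge) (p q : seq oedge) (u v w x : V).
Implicit Types (C I J P Q : {set E}) (B : {set V}).

Definition no_dead_end B J : Prop :=
  forall x e, x \notin B -> e \in J -> x \in ends G e ->
    exists e', [/\ e' \in J, e' != e & x \in ends G e'].

Lemma no_dead_endD B J C :
  no_dead_end B J -> no_dead_end (B :|: vertices G C) (J :\: C).
Proof.
move=> deg x e; rewrite inE => /norP [xB xC] /setDP [eJ _] xe.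
have [e' [e'J e'e xe']] := deg x e xB eJ xe; exists e'; split=> //.
by rewrite inE e'J andbT; apply: contra xC => e'C; apply: mem_vertices xe'.
Qed.

Definition avoiding_path B J u p w : Prop :=
  [/\ walk G u p w, uniq (u :: heads p), walk_edges p \subset J
    & {in heads p, forall x, x \notin B}].

(* Leave [u] inside [J] and extend until the head [d] meets [B] or the path. *)
Definition lollipop B J u p d : Prop :=
  [/\ avoiding_path B J u p (tail d), is_oriented G d,
      edge_of d \in J :\: walk_edges p
    & (head d \in B) || (head d \in u :: heads p)].

Lemma avoiding_path_rcons B J u p d : avoiding_path B J u p (tail d) ->
  is_oriented G d -> edge_of d \in J ->
  head d \notin B -> head d \notin u :: heads p ->
  avoiding_path B J u (rcons p d) (head d).
Proof.
move=> [pw up pJ pB] od dJ dB dp; split.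
- by rewrite walk_rcons pw od /=.
- by rewrite map_rcons -rcons_cons rcons_uniq dp.
- by rewrite walk_edges_rcons subUset sub1set dJ.
by move=> x; rewrite map_rcons mem_rcons inE => /predU1P [->|/pB].
Qed.

Lemma avoiding_path_to_lollipop B J u p w e : no_dead_end B J ->
  avoiding_path B J u p w -> e \in J :\: walk_edges p -> w \in ends G e ->
  exists q d, lollipop B J u q d.
Proof.
move=> deg; have [n] := ubnP (#|V| - size p).
elim: n p w e => // n IH p w e le_n pathp e_new we.
have [d [od de dw]] := orientation_from we.
rewrite -de in e_new; rewrite -dw in pathp.
have [closes|] := boolP ((head d \in B) || (head d \in u :: heads p)).
  by exists p, d; split.
rewrite negb_or => /andP [dB dp]; have [dJ _] := setDP e_new.
have d_head : head d \in ends G (edge_of d) by rewrite (ends_oriented od) set22.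
have [e' [e'J e'd e'_head]] := deg _ _ dB dJ d_head.
apply: (IH (rcons p d) (head d) e') => //.
- have [_ up _ _] := pathp.
  have := max_card (mem (head d :: u :: heads p)).
  rewrite (card_uniqP _) /= ?dp // size_map size_rcons => p_lt.
  by rewrite -ltnS; apply: leq_trans le_n; rewrite ltnS ltn_sub2l // ltnW.
- exact: avoiding_path_rcons.
rewrite inE e'J andbT walk_edges_rcons in_setU1 (negPf e'd) inE.
apply: contra dp => e'p; have [pw _ _ _] := pathp.
rewrite -(mem_vertices_open_walk _ pw); last by case: (p) e'p.
by apply: mem_vertices e'_head; rewrite inE.
Qed.

Lemma exists_lollipop B J u e : no_dead_end B J -> e \in J -> u \in ends G e ->
  exists p d, lollipop B J u p d.
Proof.
move=> deg eJ ue.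
apply: (avoiding_path_to_lollipop (p := [::]) deg) ue; last first.
  by rewrite walk_edges_nil setD0.
by split=> //=; rewrite walk_edges_nil sub0set.
Qed.

Lemma lollipop_cycle B J u p d :
  lollipop B J u p d -> head d \in u :: heads p ->
  exists C P,
    [/\ is_cycle G C, is_path G u (head d) P, head d \in vertices G C,
        vertices G C \subset [set x in u :: heads p] & C :|: P \subset J].
Proof.
move=> [[pw up pJ _] od /setDP [dJ d_new] _] dp.
have pdw : walk G u (rcons p d) (head d) by rewrite walk_rcons pw od eqxx.
have tailsE : u :: heads p = tails (rcons p d).
  by rewrite (walk_heads pw) map_rcons.
have ue : uniq (edges (rcons p d)).
  rewrite map_rcons rcons_uniq (path_uniq_edges pw up) andbT.
  by rewrite inE in d_new.
have pdJ : walk_edges (rcons p d) \subset J.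
  by rewrite walk_edges_rcons subUset sub1set dJ.
have := dp; rewrite tailsE => /(walk_split pdw) [p1 [d' [p2 [pE w1 w2]]]].
move: up ue; rewrite tailsE pE !map_cat !cat_uniq.
move=> /and3P [ut1 /hasPn t12 ut2] /and3P [_ _ ue2].
set C := walk_edges (d' :: p2).
have vC x : (x \in vertices G C) = (x \in tails (d' :: p2)).
  exact: mem_vertices_closed_walk w2.
exists C, (walk_edges p1); split.
- by exists (d' :: p2); split=> //; exists (head d).
- exists p1; split=> //; rewrite (walk_heads w1) rcons_uniq ut1 andbT.
  by apply/t12/(mem_tails_start w2).
- by rewrite vC (mem_tails_start w2).
- by apply/subsetP => x; rewrite vC inE mem_cat => ->; rewrite orbT.
by rewrite setUC -walk_edges_cat -pE.
Qed.

Lemma exists_cycle I e : e \in I -> no_dead_end set0 I ->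
  exists2 C, is_cycle G C & C \subset I.
Proof.
move=> eI deg; have /set0Pn [u ue] := ends_neq0 G e.
have [p [d lol]] := exists_lollipop deg eI ue.
have dp : head d \in u :: heads p by case: lol => _ _ _; rewrite in_set0.
have [C [P [cycC _ _ _]]] := lollipop_cycle lol dp.
by rewrite subUset => /andP [CI _]; exists C.
Qed.

Definition internally_disjoint u v P Q : Prop :=
  [disjoint P & Q] /\ vertices G P :&: vertices G Q = [set u; v].

Lemma is_theta_paths u v P1 P2 P3 : u != v ->
  is_path G u v P1 -> is_path G u v P2 -> is_path G u v P3 ->
  internally_disjoint u v P1 P2 -> internally_disjoint u v P1 P3 ->
  internally_disjoint u v P2 P3 -> is_theta G (P1 :|: P2 :|: P3).
Proof.
move=> uv path1 path2 path3 [disj12 V12] [disj13 V13] [disj23 V23].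
pose P (i : 'I_3) := nth P3 [:: P1; P2] i.
exists u, v, P; split=> //.
- by case=> [[|[|[|]]]].
- case=> [[|[|[|]]] hi] // [[|[|[|]]] hj] // nij; rewrite /P /=;
    by [] || by rewrite disjoint_sym.
- case=> [[|[|[|]]] hi] // [[|[|[|]]] hj] // nij; rewrite /P /=;
    by [] || by rewrite setIC.
by rewrite !big_ord_recl big_ord0 /P /= setU0 setUA.
Qed.

Lemma cycle_two_paths C u v : is_cycle G C -> u \in vertices G C ->
  v \in vertices G C -> u != v ->
  exists P1 P2, [/\ is_path G u v P1, is_path G u v P2, C = P1 :|: P2
    & internally_disjoint u v P1 P2].
Proof.
move=> cycC uC vC uv.
have [p [pw [p0 _ ut ue] pC]] := cycle_walk_from cycC uC.
move: vC; rewrite -pC (mem_vertices_closed_walk _ pw).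
move=> /(walk_split pw) [q1 [d [q2' [pE w1 w2]]]]; set q2 := d :: q2' in pE w2.
have q10 := neq_walk_nonempty w1 uv.
have ut1 := mem_tails_start w1 q10; have vt2 := mem_tails_start w2 isT.
move: ut ue; rewrite pE !map_cat !cat_uniq => /and3P [t1 /hasPn t12 t2].
move=> /and3P [_ /hasPn e12 _].
exists (walk_edges q1), (walk_edges q2); split.
- exists q1; split=> //.
  by rewrite (walk_heads w1) rcons_uniq t1 andbT; apply: t12.
- apply: is_path_sym; exists q2; split=> //.
  rewrite (walk_heads w2) rcons_uniq t2 andbT.
  by apply: contraL ut1 => /t12.
- by rewrite walk_edges_cat.
split.
  rewrite -setI_eq0; apply/set0Pn => -[e]; rewrite !inE => /andP [e1 /e12].
  by rewrite /= e1.
apply/setP => x; rewrite in_setI in_set2.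
rewrite (mem_vertices_open_walk _ w1) // (walk_heads w1) mem_rcons in_cons.
rewrite (mem_vertices_open_walk _ w2) // (walk_heads w2) mem_rcons.
rewrite [x \in u :: _]in_cons.
have [->|xu] := eqVneq x u; first by rewrite ut1 orbT.
have [->|xv] := eqVneq x v; first by rewrite vt2.
by apply/negbTE/negP => /andP [/= x1 /t12]; rewrite /= x1.
Qed.

Lemma cycle_ear_theta C u v P : is_cycle G C -> is_path G u v P -> u != v ->
  [disjoint C & P] -> vertices G P :&: vertices G C = [set u; v] ->
  is_theta G (C :|: P).
Proof.
move=> cycC pathP uv disjCP VPC.
have [uC vC] : u \in vertices G C /\ v \in vertices G C.
  by split; [have := set21 u v | have := set22 u v]; rewrite -VPC => /setIP [].
have [P1 [P2 [path1 path2 CE disj12]]] := cycle_two_paths cycC uC vC uv.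
have ear_disj Q : Q \subset C -> [set u; v] \subset vertices G Q ->
    internally_disjoint u v Q P.
  move=> QC uvQ; split; first exact: disjointWl QC disjCP.
  apply/eqP; rewrite eqEsubset subsetI uvQ -{2}VPC subsetIl andbT.
  by rewrite -VPC setIC setIS // verticesS.
rewrite CE; apply: (@is_theta_paths u v) => //; apply: ear_disj.
- by rewrite CE subsetUl.
- by have [_ <-] := disj12; rewrite subsetIl.
- by rewrite CE subsetUr.
by have [_ <-] := disj12; rewrite subsetIr.
Qed.

Lemma lollipop_ear B J u p d : lollipop B J u p d -> u \in B ->
  head d \notin u :: heads p ->
  exists P, [/\ is_path G u (head d) P, P \subset J
              & vertices G P :&: B = [set u; head d]].
Proof.
move=> [[pw up pJ pB] od /setDP [dJ _] dB] uB dp.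
have {}dB : head d \in B by rewrite (negPf dp) orbF in dB.
have pdw : walk G u (rcons p d) (head d) by rewrite walk_rcons pw od eqxx.
exists (walk_edges (rcons p d)); split.
- by exists (rcons p d); split; rewrite // map_rcons -rcons_cons rcons_uniq dp.
- by rewrite walk_edges_rcons subUset sub1set dJ.
apply/setP => x; rewrite !inE (mem_vertices_open_walk _ pdw); last by case: (p).
rewrite inE map_rcons mem_rcons inE.
have [->|xu] := eqVneq x u; first by rewrite uB.
have [->|xd] := eqVneq x (head d); first by rewrite dB.
by apply/negbTE/negP => /andP [/pB /negP].
Qed.

(* [P] need not be a minimal joining path: the handcuff may omit edges of it. *)
Lemma joined_cycles_handcuff C1 C2 P : is_cycle G C1 -> is_cycle G C2 ->
  [disjoint vertices G C1 & vertices G C2] -> joining_path G C1 C2 P ->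
  exists2 C, is_handcuff G C & C \subset C1 :|: C2 :|: P.
Proof.
move=> cyc1 cyc2 disjV joinP.
have [|Q /minsetP [/asboolP joinQ minQ] QP] :=
  minset_exists (P := fun Q => `[< joining_path G C1 C2 Q >]) (C := P).
  exact/asboolP.
exists (C1 :|: C2 :|: Q); last exact: setUS.
exists C1, C2; right; exists Q; split=> // Q' joinQ' Q'Q.
by apply: minQ => //; apply/asboolP.
Qed.

Lemma exists_handcuff_or_theta I C1 e u : is_cycle G C1 -> C1 \subset I ->
  no_dead_end set0 I ->
  e \in I :\: C1 -> u \in ends G e -> u \in vertices G C1 ->
  exists2 C, is_handcuff G C \/ is_theta G C & C \subset I.
Proof.
move=> cyc1 C1I deg eI ue uC1; set B := vertices G C1.
have degB : no_dead_end B (I :\: C1) by rewrite -[B]set0U; apply: no_dead_endD.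
have [p [d lol]] := exists_lollipop degB eI ue.
have off_C1 P : P \subset I :\: C1 -> [disjoint C1 & P] /\ P \subset I.
  by rewrite subsetD disjoint_sym => /andP [].
have [dp|dp] := boolP (head d \in u :: heads p); last first.
  have [P [pathP /off_C1 [disjP PI] VP]] := lollipop_ear lol uC1 dp.
  exists (C1 :|: P); last by rewrite subUset C1I.
  right; apply: cycle_ear_theta pathP _ disjP VP => //.
  by apply: contraNneq dp => <-; rewrite mem_head.
have [C2 [P [cyc2 pathP dC2 VC2]]] := lollipop_cycle lol dp.
rewrite subUset => /andP [/off_C1 [disj2 C2I] /off_C1 [_ PI]].
have B_VC2 x : x \in B -> x \in vertices G C2 -> x = u.
  move=> xB /(subsetP VC2); rewrite !inE => /predU1P [//|xp].
  by have [[_ _ _ pB] _ _ _] := lol; have := pB _ xp; rewrite xB.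
have [uC2|uC2] := boolP (u \in vertices G C2).
  exists (C1 :|: C2); last by rewrite subUset C1I.
  left; exists C1, C2; left; split=> //; apply/eqP/cards1P; exists u.
  apply/setP => x; rewrite !inE; apply/andP/eqP => [[xB]|->]; last by [].
  exact: B_VC2.
have disjV : [disjoint B & vertices G C2].
  rewrite -setI_eq0; apply/set0Pn => -[x /setIP [xB xC2]].
  by move: uC2; rewrite -(B_VC2 x xB xC2) xC2.
have [|C handC CI] := joined_cycles_handcuff cyc1 cyc2 disjV (P := P).
  by exists u, (head d).
by exists C; [left | apply: subset_trans CI _; rewrite !subUset C1I C2I].
Qed.

End BicyclicSubgraphs.

Section Potentials.
Variables (V E : finType) (G : multigraph V E) (gT : groupType) (T : Type).
Variables (act : gT -> T -> T) (psi : oriented_edge V E -> gT).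
Local Notation oedge := (oriented_edge V E).
Local Notation tails := (map (@tail V E)).
Local Notation heads := (map (@head V E)).
Implicit Types (d : oedge) (p : seq oedge) (u v x : V).
Implicit Types (X : {set E}) (y : V -> T).

Definition left_action : Prop :=
  (forall c, act 1%g c = c) /\
  (forall g h c, act (g * h)%g c = act g (act h c)).

Definition compatible y d : Prop := y (tail d) = act (psi d) (y (head d)).

Definition potential X y : Prop :=
  forall d, is_oriented G d -> edge_of d \in X -> compatible y d.

Lemma eq_potential X y y' :
  {in vertices G X, y =1 y'} -> potential X y -> potential X y'.
Proof.
move=> yy' pot d od dX; have endsV x : x \in [set tail d; head d] -> y x = y' x.
  by move=> xd; apply/yy'/(mem_vertices dX); rewrite (ends_oriented od).
by have := pot d od dX; rewrite /compatible !endsV ?set21 ?set22.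
Qed.

Hypothesis actP : left_action.

Lemma compatible_walk y u p v :
  walk G u p v -> {in p, forall d, compatible y d} ->
  y u = act (\prod_(d <- p) psi d)%g (y v).
Proof.
have [act1 actM] := actP.
elim: p u => [|d p IH] u /=; first by rewrite big_nil act1 => /eqP->.
move=> /and3P [_ /eqP <- pw] yp; rewrite big_cons actM -(IH _ pw).
  by apply: yp; rewrite mem_head.
by move=> d' d'p; apply: yp; rewrite inE d'p orbT.
Qed.

Lemma potential_walk X y u p v : potential X y -> walk G u p v ->
  walk_edges p \subset X -> y u = act (\prod_(d <- p) psi d)%g (y v).
Proof.
move=> pot pw /subsetP pX; apply: (compatible_walk pw) => d dp.
by apply: pot; [exact: walk_oriented pw dp | apply: pX; rewrite inE map_f].
Qed.

Lemma exists_compatible_path (y0 : V -> T) u p v : walk G u p v ->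
  uniq (tails p) -> v \notin tails p ->
  exists2 y, {in [predC tails p], y =1 y0} & {in p, forall d, compatible y d}.
Proof.
elim: p u => [|d p IH] u /=; first by exists y0.
move=> /and3P [_ /eqP tu pw] /andP [td up]; rewrite inE => /norP [vd vp].
have [y yE cy] := IH _ pw up vp.
have heads_fresh x : x \in head d :: heads p -> x != tail d.
  rewrite (walk_heads pw) mem_rcons inE => /predU1P [->//|xp].
  by apply: contraNneq td => <-.
exists (fun x => if x == tail d then act (psi d) (y (head d)) else y x).
  by move=> x; rewrite !inE => /norP [/negPf-> xp]; rewrite yE.
move=> d'; rewrite inE /compatible => /predU1P [->|d'p].
  by rewrite eqxx (negPf (heads_fresh _ _)) // mem_head.
rewrite !ifN ?cy //; last by apply: contraNneq td => <-; apply: map_f.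
by apply: heads_fresh; rewrite inE map_f ?orbT.
Qed.

Lemma exists_compatible_closed_walk u p c : walk G u p u -> uniq (tails p) ->
  act (\prod_(d <- p) psi d)%g c = c ->
  exists2 y, y u = c & {in p, forall d, compatible y d}.
Proof.
case: p => [|d p] /=; first by exists (fun=> c).
move=> /and3P [_ /eqP tu pw] /andP [td up] fix_c; rewrite tu in td.
have [y yE cy] := exists_compatible_path (fun=> c) pw up td.
have yu : y u = c by rewrite yE.
exists y => // d'; rewrite inE => /predU1P [->|/cy//].
rewrite /compatible tu (compatible_walk pw cy) yu -actP.2.
by rewrite big_cons in fix_c; rewrite fix_c.
Qed.

Hypothesis psi_gain : is_gain_function G psi.

Lemma compatible_same_edge y d d' : is_oriented G d -> is_oriented G d' ->
  edge_of d' = edge_of d -> compatible y d -> compatible y d'.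
Proof.
case: d => [[e t] h] od od' ed cd.
have [->//|->] := oriented_eqVflip od od' ed.
rewrite /flip /edge_of /tail /head /=.
have [th|th] := eqVneq t h; first by rewrite -th in cd *.
move: cd; rewrite /compatible (psi_gain od th) /tail /head /= => ->.
by rewrite -actP.2 mulgV actP.1.
Qed.

Lemma potential_orientationP (D : E -> V * V) X y : is_orientation G D ->
  potential X y <-> {in X, forall e, compatible y (e, (D e).1, (D e).2)}.
Proof.
move=> oD; split=> [pot e eX|cy d od dX]; first exact: pot.
exact: compatible_same_edge (oD _) od _ (cy _ dX).
Qed.

Lemma closed_walk_potentialP u p c :
  walk G u p u -> p != [::] -> uniq (tails p) ->
  act (\prod_(d <- p) psi d)%g c = c <->
  exists2 y, y u = c & potential (walk_edges p) y.
Proof.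
move=> pw p0 ut; split=> [fix_c|[y <- pot]]; last first.
  by rewrite -(potential_walk pot pw).
have [y yu cy] := exists_compatible_closed_walk pw ut fix_c.
exists y => // d od; rewrite inE => /mapP [d' d'p dd'].
exact: compatible_same_edge (walk_oriented pw d'p) od dd' (cy _ d'p).
Qed.

End Potentials.

Section QuotientGains.
Local Open Scope group_scope.
Variables (V E : finType) (G : multigraph V E).
Variables (gT : groupType) (H : normalSubgroup gT).
Variable psi : oriented_edge V E -> gT.

Lemma quotient_proj_eq1 g : quotient_proj H g = 1 <-> g \in nsub_pred H.
Proof.
split=> [/esym/quotient_projP|gH]; first by rewrite /coset_eq invg1 mul1g.
by apply/esym/quotient_projP; rewrite /coset_eq invg1 mul1g.
Qed.

Lemma prod_quotient_gain (p : seq (oriented_edge V E)) :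
  \prod_(d <- p) quotient_gain H psi d = quotient_proj H (\prod_(d <- p) psi d).
Proof.
elim: p => [|d p IH]; first by rewrite !big_nil.
by rewrite !big_cons IH; apply: quotient_projM.
Qed.

Lemma balanced_quotient_gainP C : balanced_cycle G (quotient_gain H psi) C <->
  exists p, [/\ simple_closed_walk G p, walk_edges p = C
              & \prod_(d <- p) psi d \in nsub_pred H].
Proof.
split=> -[p [simple_p pC bal_p]]; exists p; split=> //.
  by apply/quotient_proj_eq1; rewrite -prod_quotient_gain.
by rewrite prod_quotient_gain; apply/quotient_proj_eq1.
Qed.

End QuotientGains.

Section FrameCircuits.
Variables (V E : finType) (G : multigraph V E) (gT : groupType).
Variable phi : oriented_edge V E -> gT.
Implicit Type C : {set E}.

Lemma frame_circuit_unbalanced C : is_handcuff G C \/ is_theta G C ->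
  (forall C', is_cycle G C' -> C' \subset C -> ~ balanced_cycle G phi C') ->
  frame_circuit G phi C.
Proof.
case=> [[C1 [C2 handC]]|thetaC] unbal; last exact: Or33.
apply: Or32; exists C1, C2.
suff [[cyc1 C1C] [cyc2 C2C]] :
    (is_cycle G C1 /\ C1 \subset C) /\ (is_cycle G C2 /\ C2 \subset C).
  by split=> //; apply: unbal.
case: handC => [[cyc1 cyc2 _ _ ->]|[P [[cyc1 cyc2] _ _ _ ->]]].
  by rewrite subsetUl subsetUr.
by rewrite -setUA subsetUl setUCA subsetUl.
Qed.

Lemma frame_circuit_cases C : frame_circuit G phi C ->
  balanced_cycle G phi C \/ (is_handcuff G C \/ is_theta G C).
Proof.
case=> [balC|[C1 [C2 [handC _ _]]]|[thetaC _]]; [by left| |by right; right].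
by right; left; exists C1, C2.
Qed.

End FrameCircuits.

Section AffineActions.
Local Open Scope ring_scope.
Variable F : fieldType.

Definition affine_act (g : affine F) (x : F) : F :=
  trans_part g + mult_part g * x.
Definition linear_act (g : affine F) (x : F) : F := mult_part g * x.

Lemma affine_left_action : left_action affine_act.
Proof.
split=> [x|g h x]; last by rewrite /affine_act mult_partM mulrDr addrA mulrA.
by rewrite /affine_act /trans_part /mult_part /= add0r mul1r.
Qed.

Lemma linear_left_action : left_action linear_act.
Proof.
split=> [x|g h x]; last by rewrite /linear_act mult_partM mulrA.
by rewrite /linear_act /mult_part /= mul1r.
Qed.

End AffineActions.

Section AffineGains.
Local Open Scope ring_scope.
Variables (F : fieldType) (V E : finType) (G : multigraph V E).
Variables (psi : oriented_edge V E -> affine F) (D : E -> V * V).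
Hypothesis psi_gain : is_gain_function G psi.
Hypothesis D_orient : is_orientation G D.
Implicit Types (e : E) (u v : V) (C X : {set E}) (y : V -> F) (z : E -> F).

Local Notation linear_potential := (potential G (@linear_act F) psi).
Local Notation affine_potential := (potential G (@affine_act F) psi).
Local Notation frame_row := (lower_rows (gain_entry D psi)).
Local Notation is_N_circuit := (N_circuit G (translations F) psi).
Local Notation N_balanced :=
  (balanced_cycle G (quotient_gain (translations F) psi)).

Lemma N_balancedP C : N_balanced C <->
  exists p, [/\ simple_closed_walk G p, walk_edges p = C
              & mult_part (\prod_(d <- p) psi d)%g = 1].
Proof.
rewrite balanced_quotient_gainP.
by split=> -[p [simple_p pC /eqP bal_p]]; exists p; split=> //; apply/eqP.
Qed.

Lemma sum_frame_row y e :
  \sum_v frame_row v e * y v =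
  y (D e).1 - mult_part (psi (e, (D e).1, (D e).2)) * y (D e).2.
Proof.
rewrite /lower_rows /gain_entry; case: (D e) => v w /=.
have [->|vw] := eqVneq v w.
  rewrite (bigD1 w) //= eqxx big1 ?addr0 ?mulrBl ?mul1r //.
  by move=> u /negPf->; rewrite mul0r.
rewrite (bigD1 v) //= eqxx (bigD1 w) /= 1?eq_sym // (negPf vw) eqxx.
rewrite big1 ?addr0; last by move=> u /andP [/negPf-> /negPf->]; rewrite mul0r.
by rewrite mul1r mulNr.
Qed.

Lemma ends_orientation e : ends G e = [set (D e).1; (D e).2].
Proof. exact/eqP/(D_orient e). Qed.

Lemma frame_row_notin v e : v \notin ends G e -> frame_row v e = 0.
Proof.
rewrite ends_orientation !inE /lower_rows /gain_entry.
by case: (D e) => a b /= /norP [/negPf-> /negPf->]; case: eqP.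
Qed.

Lemma frame_row_neq0 v e :
  v \in ends G e -> ~ N_balanced [set e] -> frame_row v e != 0.
Proof.
rewrite ends_orientation !inE => ve unbal; apply/eqP => ve0; apply: unbal.
have := D_orient e; move: ve ve0; rewrite /lower_rows /gain_entry.
case: (D e) => a b /=; have [<-|ab] := eqVneq a b; last first.
  have [_ _ /eqP|_ /= ->] := eqVneq v a; first by rewrite oner_eq0.
  by move/eqP; rewrite oppr_eq0 (negPf (mult_part_neq0 _)).
rewrite orbb => -> /eqP; rewrite subr_eq0 eq_sym => /eqP loop1 od.
apply/N_balancedP; exists [:: (e, a, a)]; split=> //.
- by split=> //; exists a; rewrite /= od /= eqxx.
- by rewrite walk_edges_cons walk_edges_nil setU0.
by rewrite big_seq1.
Qed.

Lemma linear_potentialP X y :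
  linear_potential X y <-> column_relation (fun e v => frame_row v e) X y.
Proof.
rewrite (potential_orientationP (linear_left_action F) psi_gain _ _ D_orient).
split=> pot e /pot; rewrite sum_frame_row; first by move=> ->; apply: subrr.
by move/eqP; rewrite subr_eq0 => /eqP.
Qed.

Lemma affine_potentialP X : (exists y, affine_potential X y) <->
  row_spanned frame_row X (gain_entry D psi None).
Proof.
suff potP y : affine_potential X y <->
    {in X, forall e, gain_entry D psi None e = \sum_v frame_row v e * y v}.
  by split=> -[y /potP pot]; exists y.
rewrite (potential_orientationP (affine_left_action F) psi_gain _ _ D_orient).
by split=> pot e /pot; rewrite sum_frame_row /compatible /affine_act;
  rewrite /tail /head /gain_entry /=; case: (D e) => v w /= ->;
  rewrite ?addrK ?subrK.
Qed.

Lemma frame_row_vertices X v e :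
  e \in X -> v \notin vertices G X -> frame_row v e = 0.
Proof.
by move=> eX vX; apply: frame_row_notin; apply: contra vX; apply: mem_vertices.
Qed.

Lemma cycle_N_balancedP C : is_cycle G C ->
  N_balanced C <->
  exists2 y, linear_potential C y & exists2 v, v \in vertices G C & y v != 0.
Proof.
move=> cycC; split=> [/N_balancedP [p [simple_p pC bal_p]]|[y pot [v vC yv]]].
  have [p0 [u pw] ut _] := simple_p.
  have [|y yu pot] :=
    (closed_walk_potentialP (linear_left_action F) psi_gain 1 pw p0 ut).1.
    by rewrite /linear_act bal_p mulr1.
  rewrite pC in pot; exists y => //; exists u; last by rewrite yu oner_eq0.
  by rewrite -pC (mem_vertices_closed_walk _ pw) (mem_tails_start pw).
have [p [pw simple_p pC]] := cycle_walk_from cycC vC.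
apply/N_balancedP; exists p; split=> //; apply: (mulIf yv); rewrite mul1r.
by rewrite {2}(potential_walk (linear_left_action F) pot pw) ?pC.
Qed.

(* A cycle has as many vertices as edges, so the columns of [C] are dependent
   iff the rows at the vertices of [C] are. *)
Lemma cycle_dependentP C :
  is_cycle G C -> dependent frame_row V C <-> N_balanced C.
Proof.
move=> cycC; rewrite cycle_N_balancedP //.
rewrite -(dependent_rows (@frame_row_vertices C)).
rewrite dependent_tr ?card_vertices_cycle //.
split=> [[y [[v yv] yC pot]]|[y pot [v vC yv]]].
  exists y; last by exists v => //; apply: (subsetP yC).
  exact/linear_potentialP.
pose y' x := if x \in vertices G C then y x else 0.
have yy' : {in vertices G C, y =1 y'} by move=> x; rewrite /y' => ->.
exists y'; split.
- by exists v; rewrite -yy'.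
- by apply/subsetP => x; apply: contraR; rewrite /y' => /negPf->.
exact/linear_potentialP/(eq_potential yy').
Qed.

Lemma N_circuit_dependent C : is_N_circuit C -> dependent frame_row V C.
Proof.
case/frame_circuit_cases => [balC|bicyclicC].
  by apply/cycle_dependentP => //; case: balC => p [simple_p pC _]; exists p.
rewrite -(dependent_rows (@frame_row_vertices C)); apply: dependent_card.
case: bicyclicC; first exact: card_vertices_handcuff.
exact: card_vertices_theta.
Qed.

Lemma relation_no_dead_end z : column_relation frame_row V z ->
  (forall C, C \subset support z -> ~ N_balanced C) ->
  no_dead_end G set0 [set e in support z].
Proof.
move=> fz unbal x e _; rewrite inE => ze xe; apply: contrapT => dead_end.
have loop_unbal : ~ N_balanced [set e].
  by apply: unbal; apply/subsetP => e'; rewrite inE => /eqP->.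
have := fz x isT; rewrite (bigD1 e) //= big1 ?addr0 => [/eqP|e' e'e].
  rewrite mulf_eq0 (negPf (frame_row_neq0 xe loop_unbal)).
  by rewrite (negPf (ze : z e != 0)).
have [xe'|/frame_row_notin->] := boolP (x \in ends G e'); last by rewrite mul0r.
have [->|ze'] := eqVneq (z e') 0; first by rewrite mulr0.
by case: dead_end; exists e'; rewrite inE.
Qed.

Lemma relation_leaves_cycle z C : is_cycle G C -> ~ N_balanced C ->
  C \subset support z -> column_relation frame_row V z ->
  exists e u,
    [/\ e \in support z, e \notin C, u \in ends G e & u \in vertices G C].
Proof.
move=> cycC unbal /subsetP Cz fz; apply: contrapT => isolated.
case: unbal; apply/(cycle_dependentP cycC).
have /set0Pn [e0 e0C] := cycle_neq0 cycC.
exists (fun e => if e \in C then z e else 0); split.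
- by exists e0; rewrite e0C; apply: Cz.
- by apply/subsetP => e; apply: contraR => /negPf->.
move=> v _; have [vC|vC] := boolP (v \in vertices G C); last first.
  rewrite big1 // => e _; case: ifP => [eC|_]; last by rewrite mulr0.
  by rewrite (frame_row_vertices eC) ?mul0r.
rewrite -[RHS](fz v isT); apply: eq_bigr => e _; case: ifPn => // eC.
have [->|ze] := eqVneq (z e) 0; first by [].
have [ve|/frame_row_notin->] := boolP (v \in ends G e); last by rewrite !mul0r.
by case: isolated; exists e, v.
Qed.

Lemma dependent_N_circuit X : dependent frame_row V X ->
  exists2 C, is_N_circuit C & C \subset X.
Proof.
move=> [z [[e1 ze1] zX fz]]; apply: contrapT => no_circuit.
pose I := [set e in support z].
have Iz : I \subset support z by apply/subsetP => e; rewrite inE.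
have not_circuit C : C \subset support z -> ~ is_N_circuit C.
  by move=> Cz circC; apply: no_circuit; exists C => //; apply: subset_trans zX.
have unbal C : C \subset support z -> ~ N_balanced C.
  by move=> Cz balC; apply: (not_circuit _ Cz); apply: Or31.
have deg := relation_no_dead_end fz unbal.
have e1I : e1 \in I by rewrite inE.
have [C1 cyc1 C1I] := exists_cycle e1I deg; have C1z := subset_trans C1I Iz.
have [e [u [ze eC1 ue uC1]]] := relation_leaves_cycle cyc1 (unbal _ C1z) C1z fz.
have eI : e \in I :\: C1 by rewrite !inE eC1.
have [C bicyclicC CI] := exists_handcuff_or_theta cyc1 C1I deg eI ue uC1.
have Cz := subset_trans CI Iz; apply: (not_circuit C Cz).
apply: frame_circuit_unbalanced => // C' _ C'C.
by apply: unbal; apply: subset_trans Cz.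
Qed.

Lemma N_circuit_detects_dependence : detects_dependence frame_row is_N_circuit.
Proof. split; [exact: N_circuit_dependent | exact: dependent_N_circuit]. Qed.

Lemma balanced_affine_potential C :
  balanced_cycle G psi C -> exists y, affine_potential C y.
Proof.
move=> [p [[p0 [u pw] ut _] <- prod1]].
have [|y _ pot] :=
  (closed_walk_potentialP (affine_left_action F) psi_gain 0 pw p0 ut).1.
  by rewrite prod1 (affine_left_action F).1.
by exists y.
Qed.

Lemma N_balanced_affine_potential C y :
  N_balanced C -> affine_potential C y -> balanced_cycle G psi C.
Proof.
move=> /N_balancedP [p [simple_p pC mult1]] pot; exists p; split=> //.
have [_ [u pw] _ _] := simple_p.
have := potential_walk (affine_left_action F) pot pw.
rewrite pC => /(_ (subxx _)).
rewrite /affine_act mult1 mul1r -[LHS]add0r => /addIr trans0.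
exact: aff_eq.
Qed.

(* Switching by the translations [y v] moves all the gains into the stabilizer
   of [0]. *)
Lemma switch_stabilizerP C :
  (exists (eta : V -> affine F) (S : {pred affine F}), point_stabilizers S /\
     forall d, is_oriented G d -> edge_of d \in C -> switch eta psi d \in S) <->
  exists y, affine_potential C y.
Proof.
have [act1 actM] := affine_left_action F.
split=> [[eta [_ [[x ->] stab]]]|[y pot]].
  exists (fun v => affine_act (eta v) x) => d od dC.
  have /eqP fix_x := stab d od dC; rewrite /compatible.
  rewrite -[in LHS]fix_x -/(affine_act _ _) -!actM.
  by rewrite /switch !mulgA mulgV mul1g.
pose eta v := mk_affine (y v) (oner_neq0 F).
have etaE v : affine_act (eta v) 0 = y v by rewrite /affine_act mulr0 addr0.
exists eta, (stabilizer 0); split=> [|d od dC]; first by exists 0.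
rewrite inE -/(affine_act _ _) /switch !actM etaE -(pot d od dC).
by rewrite -[y _]etaE -actM mulVg act1.
Qed.

Lemma selected_circuitP C : is_N_circuit C ->
  selected_circuit G (translations F) (@point_stabilizers F) psi C <->
  row_spanned frame_row C (gain_entry D psi None).
Proof.
move=> circC; rewrite -affine_potentialP.
split=> [[_ [|[_ /switch_stabilizerP]]]|[y pot]] //.
  exact: balanced_affine_potential.
split=> //; case/frame_circuit_cases: circC => [balC|bicyclicC].
  by left; apply: N_balanced_affine_potential pot.
by right; split=> //; apply/switch_stabilizerP; exists y.
Qed.

End AffineGains.

Theorem theorem5p6 (F : fieldType) (V E : finType) (G : multigraph V E)
    (psi : oriented_edge V E -> affine F) (D : E -> V * V) :
  is_gain_function G psi -> is_orientation G D ->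
  represents (gain_matrix D psi)
    (M_rank G (translations F) (@point_stabilizers F) psi).
Proof.
move=> psi_gain D_orient X.
rewrite (represents_extra_row (N_circuit_detects_dependence psi_gain D_orient)).
congr (if _ then _ else _); apply: asbool_equiv_eq.
split=> sel C circC CX; apply/(selected_circuitP psi_gain D_orient circC);
  exact: sel.
Qed.
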